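(* Let $G$ be a simple connected undirected graph with $n\ge 2$ vertices, resistance degrees $R_1,\dots,R_n$ and second resistance degrees $T_1,\dots,T_n$. Put $$\alpha(G)=\sqrt{\frac{\sum_{i=1}^nT_i^2}{\sum_{i=1}^nR_i^2}},\qquad S(G)=\sum_{i=1}^n\sum_{j=1}^n r_{ij}^2.$$ Then $$E_R(G)\le\alpha(G)+\sqrt{(n-1)\left(S(G)-\alpha(G)^2\right)},$$ and equality holds if and only if $G$ is a complete graph.
   Context: For a connected graph $G$ with vertices $v_1,\dots,v_n$, Laplacian matrix $L$ (degree matrix minus adjacency matrix) and Moore-Penrose inverse $L^\dagger=(l^\dagger_{ij})$, the resistance distance is $r_{ij}=l^\dagger_{ii}+l^\dagger_{jj}-2l^\dagger_{ij}$, and the resistance distance matrix is $R(G)=(r_{ij})_{n\times n}$. The resistance degrees are $R_i=\sum_{j=1}^n r_{ij}$ and the second resistance degrees are $T_i=\sum_{j=1}^n r_{ij}R_j$. $S(G)$ also equals the sum of the squares of the eigenvalues of $R(G)$. The resistance energy $E_R(G)$ is the sum of the absolute values of the eigenvalues of $R(G)$, counted with multiplicity. *)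

(* Defs.v *)
From mathcomp Require Import all_boot all_order all_algebra.
From mathcomp Require Import polyrcf.

Set Implicit Arguments.
Unset Strict Implicit.
Unset Printing Implicit Defensive.

Import Order.TTheory GRing.Theory Num.Theory.
Local Open Scope ring_scope.

Section MoorePenrose.

Variable R : realFieldType.

(* The four Penrose equations, for matrices over a real field (where the
   conjugate transpose is the transpose). *)
Definition is_mpinv m n (A : 'M[R]_(m, n)) (X : 'M[R]_(n, m)) : bool :=
  [&& A *m X *m A == A, X *m A *m X == X,
      (A *m X)^T == A *m X & (X *m A)^T == X *m A].

Lemma gram_unit m n (B : 'M[R]_(m, n)) : row_free B -> B *m B^T \in unitmx.
Proof.
move=> Bfree; rewrite -row_free_unit; apply/row_freeP.
suff: kermx (B *m B^T) == 0 by rewrite kermx_eq0 => /row_freeP.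
apply/eqP/row_matrixP => i; rewrite row0.
set v := row i _.
have vBB : v *m (B *m B^T) = 0.
  by apply/sub_kermxP; rewrite /v row_sub.
have vB : v *m B = 0.
  have /matrixP/(_ 0 0) : (v *m B) *m (v *m B)^T = 0.
    by rewrite trmx_mul mulmxA -(mulmxA v) vBB mul0mx.
  rewrite !mxE => /eqP; rewrite psumr_eq0; last first.
    by move=> j _; rewrite [(_)^T _ _]mxE -expr2 sqr_ge0.
  move=> /allP w0; apply/rowP => j; rewrite [RHS]mxE.
  have := w0 j (mem_index_enum _).
  by rewrite [(_)^T _ _]mxE -expr2 sqrf_eq0 => /eqP.
by apply: (row_free_inj Bfree); rewrite mul0mx.
Qed.

Lemma mpinv_exists m n (A : 'M[R]_(m, n)) : exists X, is_mpinv A X.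
Proof.
suff fact r (C : 'M[R]_(m, r)) (B : 'M[R]_(r, n)) :
    row_free C^T -> row_free B -> exists X, is_mpinv (C *m B) X.
  rewrite -(mulmx_base A); apply: fact (row_base_free A).
  by rewrite /row_free mxrank_tr; exact: col_base_full.
move=> /gram_unit; rewrite trmxK => uC /gram_unit uB.
have BtB : (invmx (B *m B^T))^T = invmx (B *m B^T).
  by rewrite trmx_inv trmx_mul trmxK.
have CtC : (invmx (C^T *m C))^T = invmx (C^T *m C).
  by rewrite trmx_inv trmx_mul trmxK.
pose X := B^T *m invmx (B *m B^T) *m (invmx (C^T *m C) *m C^T).
have AX : C *m B *m X = C *m invmx (C^T *m C) *m C^T.
  rewrite /X -!mulmxA; congr (_ *m _).
  by rewrite !mulmxA mulmxV // mul1mx.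
have XA : X *m (C *m B) = B^T *m invmx (B *m B^T) *m B.
  rewrite /X -!mulmxA; do 2![congr (_ *m _)].
  by rewrite (mulmxA C^T) mulKmx.
exists X; apply/and4P; split; apply/eqP.
- by rewrite AX -!mulmxA (mulmxA C^T) mulKmx.
- by rewrite XA /X -!mulmxA (mulmxA B B^T) mulKVmx.
- by rewrite AX !trmx_mul trmxK CtC mulmxA.
- by rewrite XA !trmx_mul trmxK BtB mulmxA.
Qed.

Lemma mpinv_unique m n (A : 'M[R]_(m, n)) X Y :
  is_mpinv A X -> is_mpinv A Y -> X = Y.
Proof.
move=> /and4P[/eqP X1 /eqP X2 /eqP X3 /eqP X4].
move=> /and4P[/eqP Y1 /eqP Y2 /eqP Y3 /eqP Y4].
have e1 : A *m X = A *m Y.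
  by rewrite -X3 -{1}Y1 -mulmxA trmx_mul X3 Y3 mulmxA X1.
have e2 : X *m A = Y *m A.
  by rewrite -X4 -{1}Y1 mulmxA mulmxA -mulmxA trmx_mul X4 Y4 -mulmxA (mulmxA A) X1.
by rewrite -X2 e2 -mulmxA e1 mulmxA Y2.
Qed.

Definition mpinv m n (A : 'M[R]_(m, n)) : 'M[R]_(n, m) :=
  xchoose (mpinv_exists A).

Lemma mpinvP m n (A : 'M[R]_(m, n)) : is_mpinv A (mpinv A).
Proof. exact: xchooseP. Qed.

End MoorePenrose.

Section Graphs.

Variables (n : nat) (e : rel 'I_n).

Definition simple_graph : Prop := symmetric e /\ irreflexive e.

Definition connected_graph : Prop := forall i j, connect e i j.

Definition complete_graph : Prop := forall i j, i != j -> e i j.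

End Graphs.

Section Resistance.

Variables (R : rcfType) (n : nat) (e : rel 'I_n).

Definition adjacency : 'M[R]_n := \matrix_(i, j) (e i j)%:R.

Definition degree_mx : 'M[R]_n := diag_mx (\row_i #|[set j | e i j]|%:R).

Definition laplacian : 'M[R]_n := degree_mx - adjacency.

Definition resistance_mx : 'M[R]_n :=
  let Ld := mpinv laplacian in
  \matrix_(i, j) (Ld i i + Ld j j - 2 * Ld i j).

Definition resistance_degree (i : 'I_n) : R := \sum_j resistance_mx i j.

Definition second_resistance_degree (i : 'I_n) : R :=
  \sum_j resistance_mx i j * resistance_degree j.

Definition alpha : R :=
  Num.sqrt ((\sum_i second_resistance_degree i ^+ 2) /
            (\sum_i resistance_degree i ^+ 2)).

Definition resistance_sqsum : R := \sum_i \sum_j resistance_mx i j ^+ 2.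

(* [rootsR] lists the distinct roots in R, and [mup] gives multiplicities.
   The resistance matrix is symmetric, so all its eigenvalues are in R and
   none is missed. *)
Definition resistance_energy : R :=
  let p := char_poly resistance_mx in
  \sum_(x <- rootsR p) `|x| *+ mup x p.

End Resistance.

Arguments resistance_mx R {n} e.
Arguments alpha R {n} e.
Arguments resistance_sqsum R {n} e.
Arguments resistance_energy R {n} e.

(* Main.v *)
Require Import Defs.
From mathcomp Require Import all_boot all_order all_algebra.
From mathcomp Require Import polyrcf complex ring lra.
Import Order.TTheory GRing.Theory Num.Theory.
Local Open Scope ring_scope.

(** Write [A] for the resistance matrix, [1] for the all-ones vector, [alpha]
    and [S] for the two quantities of the bound.

    The matrix [A] is symmetric with zero diagonal and positive off-diagonal
    entries, and it is of negative type: if [x] is orthogonal to [1] then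
    [x A x^T = - 2 x L^+ x^T <= 0], where [L^+] is the Moore-Penrose inverse of
    the Laplacian.  Since the trace of [A] is zero, [A] has exactly one
    positive eigenvalue [lam], the other eigenvalues add up to [- lam], and the
    energy equals [2 lam] ([negative_type_spectrum]).  In particular [lam] is
    the spectral radius.

    Three inequalities then give the bound.  The Cauchy-Schwarz inequality on
    the nonpositive eigenvalues gives [n lam^2 <= (n - 1) S].  The vector of
    resistance degrees is [1 A] and that of second resistance degrees is
    [1 A A], so [alpha <= lam].  Finally the Cauchy-Schwarz inequality and the
    nonnegativity of the entries give
    [alpha^2 >= (\sum_i R_i^2) / n >= S / n].  The bound follows from
      [(n - 1) (S - alpha^2) - (2 lam - alpha)^2 =
         ((n - 1) S - n lam^2) + (lam - alpha) ((n - 4) lam + n alpha)],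
    whose two summands are nonnegative ([bound_arith]).

    Equality forces [n lam^2 = (n - 1) S], so all the nonpositive eigenvalues
    are equal to some [- c].  Then [A + c I] has rank one and constant diagonal
    [c], so every off-diagonal entry of [A] is [c].  From [L A L = - 2 L]
    follows [L L = (2 / c) L]; by connectedness the rows of [L - (2 / c) I] are
    constant, and symmetry makes all off-diagonal entries of [L] equal, so the
    graph is complete ([const_resistance_complete]).  Conversely, in a complete
    graph all the resistances are [2 / n] ([complete_resistance]), and the
    inequalities above pin down [lam = alpha = 2 (n - 1) / n]. *)

Set Implicit Arguments.
Unset Strict Implicit.
Unset Printing Implicit Defensive.

(** * Spectral theorem for symmetric matrices over a real closed field *)

Lemma row_dotE (R : pzSemiRingType) n (u v : 'rV[R]_n) :
  (u *m v^T) 0 0 = \sum_j u 0 j * v 0 j.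
Proof. by rewrite mxE; apply: eq_bigr => j _; rewrite mxE. Qed.

Lemma row_dot_ge0 (R : realFieldType) n (u : 'rV[R]_n) : 0 <= (u *m u^T) 0 0.
Proof. by rewrite row_dotE sumr_ge0 // => j _; rewrite -expr2 sqr_ge0. Qed.

Lemma row_dot_eq0 (R : realFieldType) n (u : 'rV[R]_n) :
  ((u *m u^T) 0 0 == 0) = (u == 0).
Proof.
apply/idP/eqP => [|->]; last by rewrite mul0mx mxE.
rewrite row_dotE psumr_eq0 => [/allP u0|j _]; last by rewrite -expr2 sqr_ge0.
apply/rowP => j; have := u0 j (mem_index_enum _).
by rewrite -expr2 sqrf_eq0 mxE => /eqP.
Qed.

(** An eigenvalue exists over the complexification, and it is real because the
    matrix is Hermitian there. *)
Lemma symmetric_eigenvalue (R : rcfType) n (A : 'M[R]_n.+1) :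
  A^T = A -> exists a, eigenvalue A a.
Proof.
move=> Asym; pose B := map_mx (real_complex R) A.
have [a aB] := eigenvalue_closed B (ltn0Sn n).
suff aR : a \is Num.real.
  have [x ax] : exists x : R, a = x%:C%C.
    by exists (complex.Re a); rewrite RRe_real.
  exists x; move: aB; rewrite !eigenvalue_root_char /B -map_char_poly ax.
  by rewrite (fmorph_root (real_complex R)).
have [v vB v0] := eigenvalueP aB.
pose w := map_mx Num.conj v^T.
have wE : map_mx Num.conj w = v^T.
  by apply/matrixP => i j; rewrite !mxE conjCK.
have BC : map_mx Num.conj B = B.
  by apply/matrixP => i j; rewrite !mxE; apply/CrealP; rewrite complex_real.
have BT : B^T = B by rewrite /B map_trmx Asym.
pose s := (v *m w) 0 0.
have s_gt0 : 0 < s.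
  rewrite lt_def; apply/andP; split; last first.
    by rewrite /s mxE sumr_ge0 // => j _; rewrite !mxE mul_conjC_ge0.
  apply: contra v0; rewrite /s mxE psumr_eq0 => [/allP s0|j _]; last first.
    by rewrite !mxE mul_conjC_ge0.
  apply/eqP/rowP => j; have := s0 j (mem_index_enum _).
  by rewrite !mxE mul_conjC_eq0 => /eqP.
have q : (v *m B *m w) 0 0 = a * s by rewrite vB -scalemxAl mxE.
have qC : ((v *m B *m w) 0 0)^* = (v *m B *m w) 0 0.
  transitivity ((map_mx Num.conj (v *m B *m w))^T 0 0); first by rewrite !mxE.
  rewrite !map_mxM BC wE !trmx_mul trmxK BT mulmxA.
  by rewrite map_trmx.
have sC : s^* = s by apply/CrealP; rewrite gtr0_real.
by move: qC; rewrite q rmorphM /= sC => /(mulIf (lt0r_neq0 s_gt0)) /CrealP.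
Qed.

(** Householder reflection: a symmetric orthogonal matrix that exchanges the
    first basis vector and a given unit vector. *)
Lemma householder (R : rcfType) n (v : 'rV[R]_n.+1) : (v *m v^T) 0 0 = 1 ->
  exists H : 'M[R]_n.+1,
    [/\ H^T = H, H *m H = 1%:M & delta_mx 0 0 *m H = v].
Proof.
move=> v1; pose e : 'rV[R]_n.+1 := delta_mx 0 0; pose w := e - v.
have [w0|w0] := eqVneq w 0.
  exists 1%:M; rewrite trmx1 !mulmx1; split=> //.
  by apply/eqP; rewrite -subr_eq0; apply/eqP.
pose s := (w *m w^T) 0 0.
have s0 : s != 0 by rewrite row_dot_eq0.
have ww : w *m w^T = s%:M by rewrite [LHS]mx11_scalar.
have ee : (e *m e^T) 0 0 = 1.
  by rewrite trmx_delta mul_delta_mx mxE !eqxx.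
have ev : (v *m e^T) 0 0 = (e *m v^T) 0 0.
  by rewrite -[in RHS](trmxK e) -trmx_mul [in RHS]mxE.
have ew : 2 * (e *m w^T) 0 0 = s.
  rewrite /s /w linearB /= !(mulmxBl, mulmxBr).
  have subE (X Y : 'M[R]_1) : (X - Y) 0 0 = X 0 0 - Y 0 0 by rewrite !mxE.
  by rewrite !subE v1 ee ev; ring.
have ew' : e *m w^T = (s / 2)%:M.
  by rewrite [LHS]mx11_scalar -ew; congr (_%:M); field.
have ewv : e - w = v by rewrite subKr.
clearbody w s.
exists (1%:M - (2 / s) *: (w^T *m w)); split.
- by rewrite linearB linearZ /= trmx1 trmx_mul trmxK.
- rewrite mulmxBl mul1mx mulmxBr mulmx1 -scalemxAl -scalemxAr.
  rewrite mulmxA -(mulmxA w^T) ww mul_mx_scalar -scalemxAl !scalerA.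
  rewrite (_ : 2 / s * (2 / s * s) = 2 / s + 2 / s); last by field.
  by rewrite scalerDl opprD opprK !addrA !subrK.
- rewrite mulmxBr mulmx1 -scalemxAr mulmxA ew' mul_scalar_mx scalerA.
  by rewrite (_ : 2 / s * (s / 2) = 1) ?scale1r //; field; rewrite s0.
Qed.

(** Real spectral theorem, by induction on the size: the reflection sends the
    first basis vector to a unit eigenvector, and conjugating by it leaves a
    symmetric block of size one less. *)
Theorem symmetric_diagonalization (R : rcfType) n (A : 'M[R]_n) : A^T = A ->
  exists (P : 'M[R]_n) (d : 'rV[R]_n),
    P *m P^T = 1%:M /\ A = P^T *m diag_mx d *m P.
Proof.
elim: n A => [|n IHn] A Asym.
  by exists 1%:M, 0; split; apply/matrixP => - [].
have [a /eigenvalueP[v0 v0A v0N0]] := symmetric_eigenvalue Asym.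
pose s := Num.sqrt ((v0 *m v0^T) 0 0).
have s_gt0 : 0 < s by rewrite sqrtr_gt0 lt_def row_dot_eq0 v0N0 row_dot_ge0.
pose v := s^-1 *: v0.
have vA : v *m A = a *: v by rewrite -scalemxAl v0A !scalerA mulrC.
have v1 : (v *m v^T) 0 0 = 1.
  rewrite /v linearZ /= -scalemxAl -scalemxAr scalerA mxE.
  rewrite -[X in _ * X]sqr_sqrtr ?row_dot_ge0 // -/s.
  by field; rewrite gt_eqF.
have [H [HT HH eH]] := householder v1.
pose B := H *m A *m H.
have BT : B^T = B by rewrite /B !trmx_mul HT Asym mulmxA.
have eB : delta_mx 0 0 *m B = a *: (delta_mx 0 0 : 'rV[R]_n.+1).
  by rewrite /B !mulmxA eH vA -scalemxAl -{1}eH -mulmxA HH mulmx1.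
have B0 j : B 0 j = a *+ (j == 0).
  have /rowP/(_ j) := eB; rewrite -rowE !mxE => ->.
  by rewrite eqxx mulr_natr.
have AE : A = H *m B *m H by rewrite /B !mulmxA HH mul1mx -mulmxA HH mulmx1.
clearbody B.
pose C : 'M_n := drsubmx (B : 'M_(1 + n)).
have CT : C^T = C by rewrite /C trmx_drsub BT.
have BE : (B : 'M_(1 + n)) = block_mx a%:M 0 0 C.
  rewrite -[LHS](@submxK R 1 n 1 n); congr block_mx.
  - by apply/matrixP => i j; rewrite !ord1 !mxE !lshift0 B0.
  - by apply/matrixP => i j; rewrite !ord1 !mxE lshift0 B0.
  - by apply/matrixP => i j; rewrite !ord1 !mxE lshift0 -BT mxE B0.
have [P [d [PP CE]]] := IHn _ CT.
pose Q : 'M_(1 + n) := block_mx 1%:M 0 0 P.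
have QT : Q^T = block_mx 1%:M 0 0 P^T by rewrite /Q tr_block_mx !trmx0 trmx1.
exists (Q *m H), (row_mx a%:M d); split.
  rewrite trmx_mul HT mulmxA -(mulmxA Q) HH mulmx1.
  rewrite QT /Q (@mulmx_block _ 1 n 1 n 1 n) !(mulmx0, mul0mx, mulmx1).
  by rewrite addr0 !add0r PP -(@scalar_mx_block _ 1 n).
rewrite AE.
rewrite trmx_mul HT -!mulmxA; congr (H *m _); rewrite !mulmxA; congr (_ *m H).
rewrite BE (@diag_mx_row _ n 1) QT /Q !(@mulmx_block _ 1 n 1 n 1 n).
rewrite !(mulmx0, mul0mx, mulmx1, mul1mx, addr0, add0r) -CE.
rewrite (_ : diag_mx a%:M = a%:M) //.
by apply/matrixP => i j; rewrite !ord1 !mxE.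
Qed.

(** * Spectral quantities read on a diagonalization *)

(** Summing over the distinct roots with multiplicities is the same as summing
    over the list of linear factors. *)
Lemma sum_rootsR_prod_XsubC (R : rcfType) (s : seq R) (f : R -> R) :
  let p := \prod_(y <- s) ('X - y%:P) in
  \sum_(x <- rootsR p) f x *+ mup x p = \sum_(y <- s) f y.
Proof.
move=> p.
have p0 : p != 0 by rewrite monic_neq0 ?monic_prod_XsubC.
have rootsE : perm_eq (rootsR p) (undup s).
  apply: uniq_perm; [exact: uniq_roots | exact: undup_uniq |] => x.
  by rewrite -roots_on_rootsR // in_itv /= mem_undup root_prod_XsubC.
rewrite (perm_big _ rootsE) /= -[RHS]big_undup_iterop_count.
apply: eq_bigr => x _; rewrite mu_prod_XsubC.
by rewrite Monoid.iteropE -GRing.Theory.iter_addr_0 /=.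
Qed.

Lemma char_poly_diagonalized (R : comNzRingType) n (P A : 'M[R]_n) d :
  P *m P^T = 1%:M -> A = P^T *m diag_mx d *m P ->
  char_poly A = \prod_i ('X - (d 0 i)%:P).
Proof.
move=> PP ->; have PP' := mulmx1C PP.
transitivity (char_poly (diag_mx d)); last first.
  rewrite char_poly_trig ?diag_mx_is_trig //.
  by apply: eq_bigr => i _; rewrite mxE eqxx mulr1n.
pose Q := map_mx (@polyC R) P; pose Q' := map_mx (@polyC R) P^T.
have QQ : Q' *m Q = 1%:M by rewrite -map_mxM PP' map_mx1.
rewrite /char_poly /char_poly_mx !map_mxM -/Q -/Q'.
have -> : 'X%:M - Q' *m map_mx polyC (diag_mx d) *m Q =
          Q' *m ('X%:M - map_mx polyC (diag_mx d)) *m Q.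
  by rewrite mulmxBr mulmxBl mul_mx_scalar -scalemxAl QQ scalemx1.
by rewrite !det_mulmx mulrAC -det_mulmx QQ det1 mul1r.
Qed.

Lemma diagonalized_entry (R : comNzRingType) n (P A : 'M[R]_n) d :
  A = P^T *m diag_mx d *m P ->
  forall i j, A i j = \sum_k d 0 k * (P k i * P k j).
Proof.
move=> -> i j; rewrite mul_mx_diag mxE; apply: eq_bigr => k _.
by rewrite !mxE; ring.
Qed.

Lemma diagonalized_trace (R : comNzRingType) n (P A : 'M[R]_n) d :
  P *m P^T = 1%:M -> A = P^T *m diag_mx d *m P ->
  \sum_i A i i = \sum_k d 0 k.
Proof.
move=> PP ->; rewrite -/(mxtrace _) -mulmxA mxtrace_mulC -mulmxA PP mulmx1.
exact: mxtrace_diag.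
Qed.

Lemma diagonalized_sqsum (R : comNzRingType) n (P A : 'M[R]_n) d :
  P *m P^T = 1%:M -> A = P^T *m diag_mx d *m P ->
  \sum_i \sum_j A i j ^+ 2 = \sum_k d 0 k ^+ 2.
Proof.
move=> PP AE.
have AT : A^T = A by rewrite AE !trmx_mul trmxK tr_diag_mx mulmxA.
have AA : A *m A = P^T *m diag_mx (\row_k (d 0 k ^+ 2)) *m P.
  rewrite AE !mulmxA -(mulmxA (P^T *m _)) PP mulmx1 -(mulmxA P^T) mulmx_diag.
  by congr (_ *m diag_mx _ *m _); apply/rowP => k; rewrite !mxE.
transitivity (\sum_i (A *m A) i i).
  apply: eq_bigr => i _; rewrite mxE; apply: eq_bigr => j _.
  by rewrite -{3}AT mxE.
rewrite (diagonalized_trace PP AA).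
by apply: eq_bigr => k _; rewrite mxE.
Qed.

(** The Euclidean norm is multiplied at most by the spectral radius; all norms
    and radii are squared. *)
Lemma diagonalized_norm_le (R : realFieldType) n (P A : 'M[R]_n) d (b : R) :
    P *m P^T = 1%:M -> A = P^T *m diag_mx d *m P ->
    (forall k, d 0 k ^+ 2 <= b) ->
  forall v : 'rV_n, ((v *m A) *m (v *m A)^T) 0 0 <= b * (v *m v^T) 0 0.
Proof.
move=> PP -> db v; set w := v *m P^T.
have -> : v *m v^T = w *m w^T.
  by rewrite /w trmx_mul trmxK mulmxA -(mulmxA v) (mulmx1C PP) mulmx1.
have -> : v *m (P^T *m diag_mx d *m P) = w *m diag_mx d *m P by rewrite !mulmxA.
clearbody w.
rewrite trmx_mul mulmxA -(mulmxA _ P) PP mulmx1 !row_dotE mulr_sumr.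
apply: ler_sum => k _; rewrite mul_mx_diag !mxE.
rewrite (_ : _ * _ = d 0 k ^+ 2 * (w 0 k ^+ 2)); last by ring.
by rewrite -expr2 ler_wpM2r ?sqr_ge0.
Qed.

(** A form that is nonpositive on the hyperplane orthogonal to the all-ones
    vector is positive on a subspace of dimension at most one: the span of two
    orthogonal eigenvectors meets that hyperplane. *)
Lemma negative_type_pos_eigenvalue (R : realFieldType) n (P A : 'M[R]_n) d :
    P *m P^T = 1%:M -> A = P^T *m diag_mx d *m P ->
    (forall x : 'rV_n, \sum_i x 0 i = 0 -> (x *m A *m x^T) 0 0 <= 0) ->
  forall k l, k != l -> 0 < d 0 k -> d 0 l <= 0.
Proof.
move=> PP AE neg k l kl dk; rewrite leNgt; apply/negP => dl.
have form (w : 'rV_n) : ((w *m P) *m A *m (w *m P)^T) 0 0 =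
    \sum_m d 0 m * w 0 m ^+ 2.
  rewrite AE !trmx_mul !mulmxA -(mulmxA w) PP mulmx1.
  rewrite -(mulmxA _ P) PP mulmx1.
  rewrite row_dotE; apply: eq_bigr => m _; rewrite mul_mx_diag mxE; ring.
pose sig m := \sum_i P m i.
have rowsum (w : 'rV_n) : \sum_i (w *m P) 0 i = \sum_m w 0 m * sig m.
  under eq_bigr => i _ do rewrite mxE.
  by rewrite exchange_big; apply: eq_bigr => m _; rewrite mulr_sumr.
pose w (a b : R) : 'rV_n := a *: delta_mx 0 k + b *: delta_mx 0 l.
have wE a b (f : 'I_n -> R -> R) : (forall m, f m 0 = 0) ->
    \sum_m f m (w a b 0 m) = f k a + f l b.
  move=> f0; rewrite (bigD1 k) //= (bigD1 l) 1?eq_sym //= big1 => [|m].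
    by rewrite /w !mxE !eqxx (negPf kl) eq_sym (negPf kl) /= !(mulr0, mulr1,
      addr0, add0r).
  move=> /andP[/negPf mk /negPf ml].
  by rewrite /w !mxE mk ml !andbF !mulr0 addr0.
have test a b : a * sig k + b * sig l = 0 ->
    d 0 k * a ^+ 2 + d 0 l * b ^+ 2 <= 0.
  move=> ab0; have := neg (w a b *m P); rewrite rowsum form.
  rewrite (wE a b (fun m x => x * sig m)) => [|m]; last by rewrite mul0r.
  rewrite (wE a b (fun m x => d 0 m * x ^+ 2)) => [|m];
    last by rewrite expr0n mulr0.
  exact.
(* The k-th eigenvector itself is in the hyperplane when its sum is 0. *)
have [sk|sk] := eqVneq (sig k) 0.
  have := test 1 0; rewrite sk; lra.
have := test (sig l) (- sig k) ltac:(ring).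
have := sqr_ge0 (sig l); have : 0 < sig k ^+ 2 by rewrite exprn_even_gt0.
rewrite sqrrN; nra.
Qed.

(** The spectrum of a zero-diagonal matrix of negative type.  The last two
    clauses are the Cauchy-Schwarz inequality for the nonpositive eigenvalues
    and its equality case. *)
Lemma negative_type_spectrum (R : rcfType) n (A : 'M[R]_n) :
    (1 < n)%N -> A^T = A -> (forall i, A i i = 0) ->
    (forall i j, i != j -> 0 < A i j) ->
    (forall x : 'rV_n, \sum_i x 0 i = 0 -> (x *m A *m x^T) 0 0 <= 0) ->
  exists lam : R,
    [/\ 0 < lam,
        \sum_(x <- rootsR (char_poly A)) `|x| *+ mup x (char_poly A) = 2 * lam,
        forall v : 'rV_n,
          ((v *m A) *m (v *m A)^T) 0 0 <= lam ^+ 2 * (v *m v^T) 0 0,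
        n%:R * lam ^+ 2 <= (n%:R - 1) * \sum_i \sum_j A i j ^+ 2
      & n%:R * lam ^+ 2 = (n%:R - 1) * \sum_i \sum_j A i j ^+ 2 ->
        forall i j, i != j -> A i j = lam / (n%:R - 1)].
Proof.
move=> n1 AT A0 Apos neg.
have [P [d [PP AE]]] := symmetric_diagonalization AT.
have n1R : 0 < n%:R - 1 :> R by rewrite subr_gt0 ltr1n.
have tr0 : \sum_k d 0 k = 0.
  by rewrite -(diagonalized_trace PP AE) big1.
have Sd := diagonalized_sqsum PP AE.
have [k dk] : exists k, 0 < d 0 k.
  apply/existsP; apply: contraT; rewrite negb_exists => /forallP dle.
  have d0 k : d 0 k = 0.
    apply/eqP; rewrite -oppr_eq0; apply/eqP.
    apply: (@psumr_eq0P _ _ xpredT (fun l => - d 0 l)) (isT) => [l _|].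
      by rewrite oppr_ge0 leNgt dle.
    by rewrite sumrN tr0 oppr0.
  pose i0 := Ordinal (ltnW n1); pose i1 := Ordinal n1.
  have := Apos i0 i1 isT; rewrite (diagonalized_entry AE) big1 ?ltxx //.
  by move=> k _; rewrite d0 mul0r.
have dle l : l != k -> d 0 l <= 0.
  by rewrite eq_sym => /(negative_type_pos_eigenvalue PP AE neg); apply.
set lam := d 0 k.
have restE : \sum_(l | l != k) d 0 l = - lam.
  by apply/eqP; rewrite -addr_eq0 addrC; move: tr0; rewrite (bigD1 k) //= => ->.
set S := \sum_i \sum_j A i j ^+ 2; pose c := lam / (n%:R - 1).
(* Up to the factor [n - 1], the sum of the squared deviations of the other
   eigenvalues from their mean [- c] is the Cauchy-Schwarz defect. *)
have dev : \sum_(l | l != k) (d 0 l + c) ^+ 2 =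
    ((n%:R - 1) * S - n%:R * lam ^+ 2) / (n%:R - 1).
  rewrite (eq_bigr (fun l => d 0 l ^+ 2 + 2 * c * d 0 l + c ^+ 2)); last first.
    by move=> l _; ring.
  rewrite !big_split /= -mulr_sumr restE sumr_const cardC1 card_ord.
  rewrite -[c ^+ 2 *+ _]mulr_natl -subn1 natrB ?(ltnW n1) //.
  rewrite /S Sd [in RHS](bigD1 k) //= -/lam /c.
  by field; rewrite gt_eqF.
exists lam; split=> //.
- rewrite (char_poly_diagonalized PP AE).
  have -> : \prod_i ('X - (d 0 i)%:P) =
            \prod_(y <- [seq d 0 i | i <- index_enum 'I_n]) ('X - y%:P).
    by rewrite big_map.
  rewrite (sum_rootsR_prod_XsubC _ (fun x => `|x|)) big_map (bigD1 k) //=.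
  rewrite (eq_bigr (fun l => - d 0 l)) => [|l lk];
    last by rewrite ler0_norm ?dle.
  by rewrite sumrN restE opprK gtr0_norm // -/lam; ring.
- apply: (diagonalized_norm_le PP AE) => l.
  have [->//|lk] := eqVneq l k.
  rewrite -[d 0 l ^+ 2]sqrrN ler_sqr ?nnegrE ?oppr_ge0 ?dle ?(ltW dk) //.
  rewrite -[leRHS]opprK -restE lerN2 (bigD1 l) //= gerDl.
  by apply: sumr_le0 => m /andP[mk _]; exact: dle.
- have : 0 <= ((n%:R - 1) * S - n%:R * lam ^+ 2) / (n%:R - 1).
    by rewrite -dev; apply: sumr_ge0 => l _; exact: sqr_ge0.
  by rewrite pmulr_lge0 ?invr_gt0 // subr_ge0.
move=> eqS; rewrite -/c.
have c_gt0 : 0 < c by rewrite divr_gt0.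
have dc l : l != k -> d 0 l = - c.
  move=> lk; apply/eqP; rewrite -addr_eq0 -sqrf_eq0; apply/eqP.
  apply: (psumr_eq0P (P := fun l => l != k) (F := fun l => (d 0 l + c) ^+ 2))
    lk => [m _|].
    exact: sqr_ge0.
  by rewrite dev eqS subrr mul0r.
(* [A + c I] has rank one: only the k-th eigenvalue differs from [- c]. *)
have rank1 i j : A i j + c * (i == j)%:R = (lam + c) * (P k i * P k j).
  rewrite (diagonalized_entry AE).
  have <- : \sum_l P l i * P l j = (i == j)%:R.
    have /matrixP/(_ i j) := mulmx1C PP; rewrite !mxE => <-.
    by apply: eq_bigr => l _; rewrite mxE.
  rewrite mulr_sumr -big_split (bigD1 k) //= big1 => [|l lk].
    by rewrite -/lam; ring.
  by rewrite dc //; ring.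
move=> i j ij.
have := rank1 i j; rewrite (negPf ij) mulr0 addr0 => Aij.
have := rank1 i i; have := rank1 j j; rewrite !eqxx !A0 !add0r mulr1 => Ajj Aii.
suff : A i j ^+ 2 = c ^+ 2.
  move/eqP; rewrite eqrXn2 //; first by move/eqP.
  - exact/ltW/Apos.
  - exact: ltW.
rewrite Aij expr2 [in RHS]expr2 [X in _ = X * _]Aii [X in _ = _ * X]Ajj; ring.
Qed.

(** * The Laplacian and its Moore-Penrose inverse *)

Lemma laplacian_sym (R : rcfType) n (e : rel 'I_n) :
  symmetric e -> (laplacian R e)^T = laplacian R e.
Proof.
move=> esym; apply/matrixP => i j; rewrite !mxE esym eq_sym.
by case: eqP => [->|].
Qed.

Lemma laplacian_entry (R : rcfType) n (e : rel 'I_n) i j :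
  laplacian R e i j = (\sum_l (e i l)%:R) *+ (i == j) - (e i j)%:R.
Proof.
rewrite !mxE; congr (_ *+ _ - _).
by rewrite -sum1dep_card natr_sum [in LHS]big_mkcond /=; apply: eq_bigr => l _;
  case: (e i l).
Qed.

(** The Dirichlet form: each edge is counted in both directions, whence the
    factor 2. *)
Lemma laplacian_form (R : rcfType) n (e : rel 'I_n) (x : 'rV[R]_n) :
  symmetric e ->
  2 * (x *m laplacian R e *m x^T) 0 0 =
    \sum_i \sum_j (e i j)%:R * (x 0 i - x 0 j) ^+ 2.
Proof.
move=> esym; pose q i j : R := (e i j)%:R.
have xL j : (x *m laplacian R e) 0 j =
    (\sum_l q j l) * x 0 j - \sum_i q i j * x 0 i.
  rewrite mxE (eq_bigr (fun i =>
    x 0 i * (\sum_l q i l) *+ (i == j) - q i j * x 0 i)).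
    rewrite sumrB; congr (_ - _);
      rewrite (bigD1 j) //= [X in _ + X]big1 => [|i /negPf ->] //.
    by rewrite eqxx addr0 mulr1n mulrC.
  by move=> i _; rewrite laplacian_entry -/(q i j); case: eqP => _;
    rewrite ?mulr1n ?mulr0n; ring.
rewrite row_dotE.
have -> : \sum_j (x *m laplacian R e) 0 j * x 0 j =
    \sum_j \sum_l q j l * x 0 j ^+ 2 - \sum_j \sum_i q i j * x 0 i * x 0 j.
  rewrite -sumrB; apply: eq_bigr => j _; rewrite xL mulrBl !mulr_suml;
    congr (_ - _).
  by apply: eq_bigr => l _; rewrite expr2 mulrA.
rewrite mulrBr [2 * _]mulr_natl mulr2n.
rewrite [X in _ + X - _](_ : _ = \sum_j \sum_l q j l * x 0 l ^+ 2); last first.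
  rewrite exchange_big; apply: eq_bigr => i _; apply: eq_bigr => j _.
  by rewrite /q esym.
rewrite mulr_sumr -big_split -sumrB /=; apply: eq_bigr => i _.
rewrite mulr_sumr -big_split -sumrB /=; apply: eq_bigr => j _.
by rewrite -/(q i j) [q j i](_ : _ = q i j) /q 1?esym //; ring.
Qed.

Lemma laplacian_psd (R : rcfType) n (e : rel 'I_n) (x : 'rV[R]_n) :
  symmetric e -> 0 <= (x *m laplacian R e *m x^T) 0 0.
Proof.
move=> esym; rewrite -(pmulr_rge0 _ (ltr0n R 2)) laplacian_form //.
by apply: sumr_ge0 => i _; apply: sumr_ge0 => j _; rewrite mulr_ge0 ?sqr_ge0.
Qed.

Lemma laplacian_const (R : rcfType) n (e : rel 'I_n) (x : 'rV[R]_n) :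
  symmetric e -> (forall i j, x 0 i = x 0 j) -> x *m laplacian R e = 0.
Proof.
move=> esym xc; apply/rowP => j; rewrite !mxE.
under eq_bigr => i _ do rewrite (xc i j) laplacian_entry.
rewrite -mulr_sumr sumrB (bigD1 j) //= [X in _ + X - _]big1 => [|i /negPf ->]
  //.
by rewrite eqxx addr0 (eq_bigr (fun i => (e i j)%:R)) ?subrr ?mulr0 // => i _;
  rewrite esym.
Qed.

Lemma laplacian_form_eq0 (R : rcfType) n (e : rel 'I_n) (x : 'rV[R]_n) :
  symmetric e -> connected_graph e ->
  (x *m laplacian R e *m x^T) 0 0 = 0 -> forall i j, x 0 i = x 0 j.
Proof.
move=> esym econ x0.
have adj i j : e i j -> x 0 i = x 0 j.
  move=> eij; have := laplacian_form x esym;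
    rewrite x0 mulr0 => /(@Logic.eq_sym _ _ _) F0.
  have pos a b : 0 <= (e a b)%:R * (x 0 a - x 0 b) ^+ 2.
    by rewrite mulr_ge0 ?sqr_ge0.
  have Fi := psumr_eq0P (P := xpredT)
    (fun a _ => sumr_ge0 _ (fun b _ => pos a b)) F0 (i := i) isT.
  have := psumr_eq0P (P := xpredT) (fun b _ => pos i b) Fi (i := j) isT.
  by rewrite eij mul1r => /eqP; rewrite sqrf_eq0 subr_eq0 => /eqP.
move=> i j; have /connectP[p] := econ i j.
elim: p i => [i _ -> //|k p IHp i /= /andP[eik pk] jE].
by rewrite (adj _ _ eik); exact: IHp.
Qed.

Lemma mpinv_sym (R : realFieldType) n (A : 'M[R]_n) :
  A^T = A -> (mpinv A)^T = mpinv A.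
Proof.
move=> AT; apply: (@mpinv_unique _ _ _ A); last exact: mpinvP.
have /and4P[/eqP X1 /eqP X2 /eqP X3 /eqP X4] := mpinvP A.
have t1 : A *m (mpinv A)^T = mpinv A *m A by rewrite -X4 trmx_mul AT.
have t2 : (mpinv A)^T *m A = A *m mpinv A by rewrite -X3 trmx_mul AT.
have p1 : A *m (mpinv A)^T *m A = A.
  by have := congr1 trmx X1; rewrite !trmx_mul AT mulmxA.
have p2 : (mpinv A)^T *m A *m (mpinv A)^T = (mpinv A)^T.
  by have := congr1 trmx X2; rewrite !trmx_mul AT mulmxA.
by rewrite /is_mpinv p1 p2 t1 t2 X3 X4 !eqxx.
Qed.

Lemma mpinv_laplacian_form (R : rcfType) n (e : rel 'I_n) (x : 'rV[R]_n) :
  symmetric e ->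
  let y := x *m mpinv (laplacian R e) in
  (x *m mpinv (laplacian R e) *m x^T) 0 0 = (y *m laplacian R e *m y^T) 0 0.
Proof.
move=> esym y; have LT := laplacian_sym R esym.
rewrite trmx_mul (mpinv_sym LT) /y !mulmxA.
have /and4P[_ /eqP X2 _ _] := mpinvP (laplacian R e).
by rewrite -[in RHS](mulmxA x) -[in RHS](mulmxA x) X2.
Qed.

Lemma mpinv_laplacian_psd (R : rcfType) n (e : rel 'I_n) (x : 'rV[R]_n) :
  symmetric e -> 0 <= (x *m mpinv (laplacian R e) *m x^T) 0 0.
Proof. by move=> esym; rewrite mpinv_laplacian_form // laplacian_psd. Qed.

(** The pseudo-inverse is degenerate only on constant vectors, like the
    Laplacian itself. *)
Lemma mpinv_laplacian_form_eq0 (R : rcfType) n (e : rel 'I_n) (x : 'rV[R]_n) :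
  symmetric e -> connected_graph e ->
  (x *m mpinv (laplacian R e) *m x^T) 0 0 = 0 -> forall i j, x 0 i = x 0 j.
Proof.
move=> esym econ; set L := laplacian R e;
  have LT : L^T = L := laplacian_sym R esym.
have XT := mpinv_sym LT; have /and4P[/eqP X1 _ /eqP X3 _] := mpinvP L.
rewrite mpinv_laplacian_form // => /(laplacian_form_eq0 esym econ) yc.
apply: laplacian_form_eq0 => //; rewrite -/L.
have yL : x *m mpinv L *m L = 0 by exact: laplacian_const.
(* The pseudo-inverse of a symmetric matrix commutes with it. *)
have -> : x *m L = x *m mpinv L *m L *m L.
  by rewrite -{1}X1 -{1}X3 trmx_mul XT LT !mulmxA.
by rewrite yL !mul0mx mxE.
Qed.

(** * The resistance matrix *)

Lemma resistance_mx_sym (R : rcfType) n (e : rel 'I_n) :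
  symmetric e -> (resistance_mx R e)^T = resistance_mx R e.
Proof.
move=> esym; apply/matrixP => i j; rewrite !mxE.
by rewrite -{3}(mpinv_sym (laplacian_sym R esym)) mxE; ring.
Qed.

Lemma resistance_mx_diag (R : rcfType) n (e : rel 'I_n) i :
  resistance_mx R e i i = 0.
Proof. by rewrite mxE; ring. Qed.

Lemma resistance_mxE (R : rcfType) n (e : rel 'I_n)
    (X := mpinv (laplacian R e)) :
  resistance_mx R e = (\row_i X i i)^T *m const_mx 1 +
    (const_mx 1)^T *m (\row_i X i i) - 2 *: X.
Proof.
by apply/matrixP => i j; rewrite !mxE !big_ord1 !mxE mul1r mulr1.
Qed.

(** On sum-zero vectors only the pseudo-inverse part of the resistance matrix
    contributes. *)
Lemma resistance_mx_form (R : rcfType) n (e : rel 'I_n) (x : 'rV[R]_n) :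
  \sum_i x 0 i = 0 ->
  (x *m resistance_mx R e *m x^T) 0 0 =
    - 2 * (x *m mpinv (laplacian R e) *m x^T) 0 0.
Proof.
move=> x0; rewrite resistance_mxE.
have x1 : x *m (const_mx 1 : 'rV[R]_n)^T = 0.
  apply/matrixP => i j; rewrite !ord1 !mxE -[RHS]x0.
  by apply: eq_bigr => k _; rewrite !mxE mulr1.
have x1' : (const_mx 1 : 'rV[R]_n) *m x^T = 0.
  by apply: trmx_inj; rewrite trmx_mul trmxK x1 trmx0.
rewrite mulmxBr mulmxDr !mulmxBl mulmxDl !mulmxA x1 !mul0mx addr0.
by rewrite -(mulmxA _ (const_mx 1) x^T) x1' mulmx0 sub0r -scalemxAr -scalemxAl
  !mxE mulNr.
Qed.

Lemma resistance_mx_negative_type (R : rcfType) n (e : rel 'I_n)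
    (x : 'rV[R]_n) :
  symmetric e -> \sum_i x 0 i = 0 -> (x *m resistance_mx R e *m x^T) 0 0 <= 0.
Proof.
move=> esym /(resistance_mx_form e) ->.
by rewrite mulNr oppr_le0 mulr_ge0 ?mpinv_laplacian_psd.
Qed.

Lemma resistance_mx_diff_form (R : rcfType) n (e : rel 'I_n) i j
    (x : 'rV[R]_n := delta_mx 0 i - delta_mx 0 j) :
  symmetric e ->
  resistance_mx R e i j = (x *m mpinv (laplacian R e) *m x^T) 0 0.
Proof.
move=> esym; rewrite mxE; have := mpinv_sym (laplacian_sym R esym).
move: (mpinv _) => X XT.
rewrite /x linearB /= !trmx_delta mulmxBr !mulmxBl -!rowE -!colE.
have Xji : X j i = X i j by rewrite -{1}XT mxE.
rewrite !mxE Xji; ring.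
Qed.

Lemma resistance_mx_gt0 (R : rcfType) n (e : rel 'I_n) i j :
  symmetric e -> connected_graph e -> i != j -> 0 < resistance_mx R e i j.
Proof.
move=> esym econ ij; rewrite resistance_mx_diff_form //.
rewrite lt_def mpinv_laplacian_psd // andbT; apply/eqP.
move=> /(mpinv_laplacian_form_eq0 esym econ) /(_ i j) /eqP.
rewrite !mxE !eqxx [j == i]eq_sym (negPf ij) /= subr0 sub0r.
by rewrite -addr_eq0 -mulr2n pnatr_eq0.
Qed.

(** The identity [L A L = - 2 L], with [L] the Laplacian and [A] the resistance
    matrix: the rank-one terms of [A] are killed by [L]. *)
Lemma laplacian_resistance (R : rcfType) n (e : rel 'I_n) (L := laplacian R e) :
  symmetric e -> L *m resistance_mx R e *m L = - 2 *: L.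
Proof.
move=> esym; have LT : L^T = L := laplacian_sym R esym.
have oneL : (const_mx 1 : 'rV_n) *m L = 0.
  by apply: laplacian_const => // i j; rewrite !mxE.
have Lone : L *m (const_mx 1 : 'rV_n)^T = 0.
  by apply: trmx_inj; rewrite trmx_mul trmxK LT oneL trmx0.
have /and4P[/eqP X1 _ _ _] := mpinvP L.
rewrite resistance_mxE -/L; clearbody L.
rewrite mulmxBr mulmxDr !mulmxBl mulmxDl !mulmxA Lone !mul0mx addr0.
by rewrite -(mulmxA _ (const_mx 1) L) oneL mulmx0 sub0r -scalemxAr -scalemxAl
  X1 scaleNr.
Qed.

(** * Constant resistances and complete graphs *)

Lemma const_resistance_complete (R : rcfType) n (e : rel 'I_n) (c : R) :
  simple_graph e -> connected_graph e -> 0 < c ->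
  (forall i j, i != j -> resistance_mx R e i j = c) -> complete_graph e.
Proof.
move=> [esym eirr] econ c0 Rc; set L := laplacian R e.
have LT : L^T = L := laplacian_sym R esym.
pose J : 'M[R]_n := (const_mx 1 : 'rV_n)^T *m (const_mx 1 : 'rV_n).
have RE : resistance_mx R e = c *: (J - 1%:M).
  have JE i j : (c *: (J - 1%:M)) i j = c * (1 - (i == j)%:R).
    by rewrite !mxE big_ord1 !mxE mulr1.
  apply/matrixP => i j; rewrite JE.
  by have [->|ij] := eqVneq i j; rewrite ?resistance_mx_diag ?Rc //=; ring.
have LL : L *m L = (2 / c) *: L.
  have := laplacian_resistance R esym; rewrite -/L RE.
  have oneL : L *m (const_mx 1 : 'rV_n)^T = 0.
    apply: trmx_inj; rewrite trmx_mul trmxK LT trmx0.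
    by apply: laplacian_const => // i j; rewrite !mxE.
  rewrite -scalemxAr (mulmxBr _ J) mulmxA oneL mul0mx sub0r mulmx1 scalerN
    mulNmx.
  rewrite scaleNr => /oppr_inj; rewrite -scalemxAl => cLL.
  by rewrite mulrC -scalerA -cLL scalerA mulVf ?scale1r // gt_eqF.
(* The rows of [M] are in the kernel of [L], so they are constant. *)
pose M := L - (2 / c)%:M.
have ML : M *m L = 0 by rewrite mulmxBl LL mul_scalar_mx subrr.
have MT i j : M i j = M j i.
  by rewrite -{1}[M](_ : M^T = M) ?mxE // /M linearB /= LT tr_scalar_mx.
have Mrow i j k : M i j = M i k.
  have := @laplacian_form_eq0 R n e (row i M) esym econ.
  by rewrite -/L -row_mul ML row0 mul0mx mxE => /(_ erefl j k); rewrite !mxE.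
have Moff i j : i != j -> M i j = - (e i j)%:R.
  by move=> ij; rewrite /M mxE laplacian_entry !mxE (negPf ij) !mulr0n; ring.
move=> i j ij; apply: contraT => eij.
have M0 a b : M a b = 0.
  by rewrite (Mrow a b i) MT (Mrow i a j) Moff // (negPf eij) oppr0.
have noedge a b : e a b = false.
  have [->|ab] := eqVneq a b; first exact: eirr.
  have /eqP := M0 a b; rewrite Moff // oppr_eq0.
  by case: (e a b) => //; rewrite oner_eq0.
have /connectP[[|k p] /=] := econ i j; last by rewrite noedge.
by move=> _ ji; rewrite ji eqxx in ij.
Qed.

Lemma complete_resistance (R : rcfType) n (e : rel 'I_n) :
  simple_graph e -> complete_graph e ->
  forall i j, i != j -> resistance_mx R e i j = 2 / n%:R.
Proof.
move=> [esym eirr] ecomp i j ij; set L := laplacian R e.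
have n0 : n%:R != 0 :> R.
  by rewrite pnatr_eq0 -lt0n (leq_ltn_trans _ (ltn_ord i)).
have eE a b : (e a b)%:R = 1 - (a == b)%:R :> R.
  by have [->|/ecomp->] := eqVneq a b; rewrite ?eirr ?subrr ?subr0.
have LE a b : L a b = n%:R *+ (a == b) - 1.
  rewrite laplacian_entry (eq_bigr (fun l => 1 - (a == l)%:R)) => [|l _];
    last exact: eE.
  rewrite eE sumrB sumr_const card_ord (bigD1 a) //= eqxx big1 => [|l];
    last first.
    by rewrite eq_sym => /negPf ->.
  by case: eqP => _; rewrite /= ?mulr1n ?mulr0n; ring.
rewrite resistance_mx_diff_form //.
set x : 'rV[R]_n := _ - _.
have x0 : \sum_a x 0 a = 0.
  rewrite /x; under eq_bigr => a _ do rewrite !mxE eqxx /=.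
  rewrite sumrB (bigD1 i) //= eqxx big1 => [|a /negPf ->] //.
  rewrite (bigD1 j) //= eqxx big1 => [|a /negPf ->] //.
  by rewrite mulr1n !addr0 subrr.
(* The Laplacian of the complete graph is [n] times the identity on sum-zero
   vectors. *)
have xL : x *m L = n%:R *: x.
  apply/rowP => b; rewrite mxE [RHS]mxE.
  rewrite (eq_bigr (fun a => n%:R * (x 0 a *+ (a == b)) - x 0 a)) => [|a _].
    rewrite sumrB x0 -mulr_sumr (bigD1 b) //= eqxx big1 => [|a /negPf ->] //.
    by rewrite mulr1n addr0 subr0.
  by rewrite LE; case: eqP => _; rewrite /= ?mulr1n ?mulr0n; ring.
have LT : L^T = L := laplacian_sym R esym.
have xx : (x *m x^T) 0 0 = 2.
  rewrite /x linearB /= !trmx_delta mulmxBr !mulmxBl !mul_delta_mx_cond.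
  by rewrite !eqxx [j == i]eq_sym (negPf ij) /= !mulr0n !mulr1n !mxE /= !subr0
    sub0r opprK -mulr2n.
clearbody x.
have xE : x = n%:R^-1 *: (x *m L) by rewrite xL scalerA mulVf ?scale1r.
have xTE : x^T = n%:R^-1 *: (L *m x^T).
  by rewrite {1}xE linearZ /= trmx_mul LT.
have /and4P[/eqP X1 _ _ _] := mpinvP L.
have xLXLx : x *m L *m mpinv L *m (L *m x^T) = n%:R *: (x *m x^T).
  by rewrite !mulmxA -(mulmxA x L) -(mulmxA x _ L) X1 xL -scalemxAl.
rewrite {1}xE {1}xTE -!scalemxAl -scalemxAr xLXLx !scalerA mxE xx.
by field.
Qed.

(** * The bound *)

Lemma sumsq_le_sqsum (R : realDomainType) (I : finType) (f : I -> R) :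
  (forall i, 0 <= f i) -> \sum_i f i ^+ 2 <= (\sum_i f i) ^+ 2.
Proof.
move=> f0; rewrite [leRHS]expr2 mulr_suml; apply: ler_sum => i _.
by rewrite expr2 ler_wpM2l // (bigD1 i) //= lerDl sumr_ge0.
Qed.

Lemma sqsum_le_sumsq (R : realFieldType) n (f : 'I_n -> R) :
  (\sum_i f i) ^+ 2 <= n%:R * \sum_i f i ^+ 2.
Proof.
have [n0|n0] := posnP n.
  by rewrite !big1 ?expr0n ?mulr0 //= => i; have := ltn_ord i; rewrite {2}n0.
have nR : 0 < n%:R :> R by rewrite ltr0n.
set s := \sum_i f i; set q := \sum_i _.
have : 0 <= \sum_i (f i - s / n%:R) ^+ 2 by apply: sumr_ge0 => i _;
  exact: sqr_ge0.
rewrite (eq_bigr (fun i => f i ^+ 2 - 2 * (s / n%:R) * f i + (s / n%:R) ^+ 2));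
  last first.
  by move=> i _; ring.
rewrite big_split sumrB -mulr_sumr -/s -/q sumr_const card_ord -[_ ^+ 2 *+
  _]mulr_natl /=.
have -> : q - 2 * (s / n%:R) * s + n%:R * (s / n%:R) ^+ 2 =
    (n%:R * q - s ^+ 2) / n%:R.
  by field; rewrite gt_eqF.
by rewrite pmulr_lge0 ?invr_gt0 // subr_ge0.
Qed.

(** The scalar inequality behind the bound.  In the product
    [(lam - a) ((n - 4) lam + n a)] the second factor is nonnegative for
    [n >= 3], while for [n = 2] the hypotheses force [lam = a]. *)
Lemma bound_arith (R : rcfType) n (lam a S : R) : (1 < n)%N ->
    0 < lam -> 0 <= a -> a <= lam -> S <= n%:R * a ^+ 2 ->
    n%:R * lam ^+ 2 <= (n%:R - 1) * S ->
  let bound := a + Num.sqrt ((n%:R - 1) * (S - a ^+ 2)) in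
  2 * lam <= bound /\ (2 * lam = bound -> n%:R * lam ^+ 2 = (n%:R - 1) * S).
Proof.
move=> n1 lam0 a0 alam Sa lamS; set q := (n%:R - 1) * _; move=> bound.
have n1R : 0 < n%:R - 1 :> R by rewrite subr_gt0 ltr1n.
have prod_ge0 : 0 <= (lam - a) * ((n%:R - 4) * lam + n%:R * a).
  have le2 : lam ^+ 2 <= (n%:R - 1) * a ^+ 2.
    have : n%:R * lam ^+ 2 <= n%:R * ((n%:R - 1) * a ^+ 2).
      by apply: le_trans lamS _; rewrite mulrCA ler_wpM2l // ltW.
    by rewrite ler_pM2l // ltr0n ltnW.
  case: n n1 le2 {Sa lamS q bound n1R} => [|[|[|[|n]]]] // _ le2.
  - have -> : lam = a by apply/eqP; rewrite eq_le alam andbT; nra.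
    by rewrite subrr mul0r.
  - by rewrite mulr_ge0 ?subr_ge0 //; nra.
  - rewrite mulr_ge0 ?subr_ge0 // addr_ge0 // mulr_ge0 ?subr_ge0 ?(ltW lam0) //.
    by rewrite ler_nat.
have qE : q - (2 * lam - a) ^+ 2 = ((n%:R - 1) * S - n%:R * lam ^+ 2) +
    (lam - a) * ((n%:R - 4) * lam + n%:R * a) by rewrite /q; ring.
have dlam : 0 <= 2 * lam - a by lra.
have sq : (2 * lam - a) ^+ 2 <= q.
  by rewrite -subr_ge0 qE addr_ge0 // subr_ge0.
have q0 : 0 <= q by apply: le_trans (sqr_ge0 _) sq.
split.
  rewrite /bound -lerBlDl -[leLHS](ger0_norm dlam) -sqrtr_sqr.
  exact: ler_wsqrtr.
move=> eqb; have : 2 * lam - a = Num.sqrt q by rewrite eqb /bound; ring.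
move=> /(congr1 (fun z => z ^+ 2)); rewrite sqr_sqrtr // => qE'.
move: qE; rewrite -qE' subrr => qE.
apply/eqP; rewrite eq_le lamS -subr_le0 /=; lra.
Qed.

Theorem theorem4p2 (R : rcfType) (n : nat) (e : rel 'I_n)
    (hn : (2 <= n)%N) (hsimple : simple_graph e) (hconn : connected_graph e) :
  let bound : R :=
    alpha R e + Num.sqrt ((n%:R - 1) * (resistance_sqsum R e - alpha R e ^+ 2)) in
  resistance_energy R e <= bound /\
  (resistance_energy R e = bound <-> complete_graph e).
Proof.
have [esym eirr] := hsimple; set A := resistance_mx R e.
have nR : 0 < n%:R :> R by rewrite ltr0n ltnW.
have n1R : 0 < n%:R - 1 :> R by rewrite subr_gt0 ltr1n.
have AT : A^T = A := resistance_mx_sym R esym.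
have A0 := @resistance_mx_diag R n e.
have Apos i j := @resistance_mx_gt0 R n e i j esym hconn.
have Age0 i j : 0 <= A i j.
  by have [->|/Apos/ltW] := eqVneq i j; rewrite ?A0.
have [lam [lam0 energyE normA lamS lamS_eq]] :=
  negative_type_spectrum hn AT A0 Apos (fun x => resistance_mx_negative_type
    esym).
pose deg := resistance_degree R e; pose deg2 := second_resistance_degree R e.
have degE i : ((const_mx 1 : 'rV_n) *m A) 0 i = deg i.
  rewrite mxE; apply: eq_bigr => j _.
  by rewrite -{1}AT !mxE mul1r.
have deg2E i : ((const_mx 1 : 'rV_n) *m A *m A) 0 i = deg2 i.
  by rewrite mxE; apply: eq_bigr => j _; rewrite degE mulrC -{1}AT mxE.
set S := resistance_sqsum R e; rewrite -[X in _ <= _ * X]/S in lamS.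
(* The squared norms of the vectors [1 A] and [1 A A]. *)
pose D := \sum_i deg i ^+ 2; pose T := \sum_i deg2 i ^+ 2.
have S_le : S <= D by apply: ler_sum => i _; exact: sumsq_le_sqsum.
have S_gt0 : 0 < S.
  rewrite -(pmulr_rgt0 _ n1R); apply: lt_le_trans lamS.
  by rewrite mulr_gt0 ?exprn_gt0.
have D_gt0 : 0 < D := lt_le_trans S_gt0 S_le.
have D_lam : D <= n%:R * lam ^+ 2.
  have := normA (const_mx 1); rewrite !row_dotE mulrC.
  rewrite (eq_bigr (fun i => deg i ^+ 2)) => [|i _]; last by rewrite degE expr2.
  rewrite [X in X * _](eq_bigr (fun=> 1)) => [|i _]; last by rewrite !mxE mulr1.
  by rewrite sumr_const card_ord.
have T_lam : T <= lam ^+ 2 * D.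
  have := normA ((const_mx 1 : 'rV_n) *m A); rewrite !row_dotE.
  rewrite (eq_bigr (fun i => deg2 i ^+ 2)) => [|i _];
    last by rewrite deg2E expr2.
  by rewrite [X in _ * X](eq_bigr (fun i => deg i ^+ 2)) // => i _;
    rewrite degE expr2.
have DE : \sum_i deg2 i = D.
  rewrite /deg2 /second_resistance_degree exchange_big;
    apply: eq_bigr => j _ /=.
  rewrite -mulr_suml expr2; congr (_ * _); apply: eq_bigr => i _.
  by rewrite -/A -{1}AT mxE.
have T_D : D ^+ 2 <= n%:R * T by rewrite -DE; exact: sqsum_le_sumsq.
have alpha_ge0 : 0 <= alpha R e by exact: sqrtr_ge0.
have alphaE : alpha R e ^+ 2 = T / D.
  by rewrite sqr_sqrtr // divr_ge0 // sumr_ge0 // => i _; exact: sqr_ge0.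
have alpha_le : alpha R e <= lam.
  by rewrite -ler_sqr ?nnegrE ?(ltW lam0) // alphaE ler_pdivrMr.
have S_alpha : S <= n%:R * alpha R e ^+ 2.
  rewrite alphaE mulrA ler_pdivlMr //; apply: le_trans T_D.
  by rewrite expr2 ler_wpM2r // ltW.
have [le_bound eq_bound] := bound_arith hn lam0 alpha_ge0 alpha_le S_alpha lamS.
have -> : resistance_energy R e = 2 * lam by exact: energyE.
move=> bound; split=> //; split=> [/eq_bound/lamS_eq Aconst | ecomp].
  by apply: const_resistance_complete Aconst => //; rewrite divr_gt0.
have Ac := complete_resistance R hsimple ecomp.
pose c : R := 2 / n%:R.
have c_gt0 : 0 < c by rewrite divr_gt0.
have rowc (f : R -> R) i : f 0 = 0 -> \sum_j f (A i j) = (n%:R - 1) * f c.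
  move=> f0; rewrite (bigD1 i) //= A0 f0 add0r (eq_bigr (fun=> f c)) => [|j].
    by rewrite sumr_const cardC1 card_ord -[_ *+ _.-1]mulr_natl -subn1 natrB //
      ltnW.
  by rewrite eq_sym => /Ac; rewrite -/A => ->.
have degc i : deg i = (n%:R - 1) * c by exact: (rowc id).
have SE : S = n%:R * ((n%:R - 1) * c ^+ 2).
  rewrite /S /resistance_sqsum (eq_bigr (fun=> (n%:R - 1) * c ^+ 2)) => [|i _].
    by rewrite sumr_const card_ord mulr_natl.
  by apply: (rowc (fun x => x ^+ 2)); rewrite expr0n.
have DcE : D = n%:R * ((n%:R - 1) * c) ^+ 2.
  by rewrite /D; under eq_bigr => i _ do rewrite degc;
    rewrite sumr_const card_ord mulr_natl.
pose m := (n%:R - 1) * c.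
have m_gt0 : 0 < m by rewrite mulr_gt0.
(* The all-ones vector bounds [lam] below by [m], and [n lam^2 <= (n - 1) S]
   bounds it above by [m]. *)
have lamE : lam = m.
  apply/eqP; rewrite eq_le; apply/andP; split.
    rewrite -ler_sqr ?nnegrE ?(ltW lam0) ?(ltW m_gt0) // -(ler_pM2l nR);
      apply: le_trans lamS _.
    by rewrite SE /m le_eqVlt; apply/orP; left; apply/eqP; ring.
  by rewrite -ler_sqr ?nnegrE ?(ltW lam0) ?(ltW m_gt0) // -(ler_pM2l nR) -DcE.
have alpha_m : alpha R e = m.
  have T_E : T = n%:R * (m * m) ^+ 2.
    rewrite /T /deg2 /second_resistance_degree.
    rewrite (eq_bigr (fun=> (m * m) ^+ 2)) => [|i _].
      by rewrite sumr_const card_ord mulr_natl.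
    congr (_ ^+ 2); under eq_bigr => j _ do rewrite -/(deg j) degc.
    by rewrite -mulr_suml; congr (_ * _); exact: degc.
  apply/eqP; rewrite -(@eqrXn2 _ 2) ?(ltW m_gt0) // alphaE T_E DcE; apply/eqP.
  by rewrite -/m; field; rewrite !gt_eqF.
rewrite /bound -/S alpha_m lamE.
have -> : (n%:R - 1) * (S - m ^+ 2) = m ^+ 2 by rewrite SE /m; ring.
by rewrite sqrtr_sqr gtr0_norm //; ring.
Qed.
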